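(* Assume $\mathfrak{A}\cap\Lambda=\emptyset$. Then for every positive integer $N$, $$B_N(z)\;=\;z^{N^n}\exp\left(-\sum_{k\geq 1}\sum_{\gamma\in\Gamma_N(2k)}\mathrm{weight}(\gamma)\,z^{-k}\right).$$
   Context: Setting: $\mathfrak{A}\subset\mathbb{Z}^n$ is a finite set, and $c_{\mathsf a}$ ($\mathsf a\in\mathfrak{A}$) are positive integers. $\Lambda\subset\mathbb{Z}^n$ is the lattice spanned over $\mathbb{Z}$ by all differences $\mathsf a-\mathsf b$ with $\mathsf a,\mathsf b\in\mathfrak{A}$; it is assumed that $\Lambda$ has rank $n$. The dual lattice is $\Lambda^\vee=\{\mathsf t\in\mathbb{R}^n \mid \langle \mathsf t,\mathsf a-\mathsf b\rangle\in\mathbb{Z}\ \forall\,\mathsf a,\mathsf b\in\mathfrak{A}\}$, where $\langle\cdot,\cdot\rangle$ is the standard inner product. Polynomials $B_N$: let $\widehat{\mathcal D}(\mathsf t)=\sum_{\mathsf a\in\mathfrak{A}}c_{\mathsf a}e^{-2\pi i\langle \mathsf t,\mathsf a\rangle}$ for $\mathsf t\in\mathbb{R}^n$; the function $|\widehat{\mathcal D}(\mathsf t)|^2=\sum_{\mathsf a,\mathsf b\in\mathfrak{A}}c_{\mathsf a}c_{\mathsf b}e^{2\pi i\langle \mathsf t,\mathsf a-\mathsf b\rangle}$ is $\Lambda^\vee$-periodic. For $N\in\mathbb{N}$ and $r\in\mathbb{R}$ let $\mathrm{mult}_N(r)=\#\{\mathsf t\in\frac1N\Lambda^\vee/\Lambda^\vee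 \mid |\widehat{\mathcal D}(\mathsf t)|^2=r\}$ and $$B_N(z)=\prod_{r\in\mathbb{R}}(z-r)^{\mathrm{mult}_N(r)}.$$ Graphs: when $\mathfrak{A}\cap\Lambda=\emptyset$, let $\Gamma$ be the weighted bipartite graph whose set of black vertices is $\Lambda$ and whose set of white vertices is $\mathfrak{A}+\Lambda$ (a single coset of $\Lambda$ in $\mathbb{Z}^n$). There is an (oriented) edge from vertex $\mathsf v_1$ to vertex $\mathsf v_2$ if and only if $\mathsf v_1$ is black, $\mathsf v_2$ is white and $\mathsf v_2-\mathsf v_1\in\mathfrak{A}$; if $\mathsf v_2-\mathsf v_1=\mathsf a\in\mathfrak{A}$, the edge is of type $\mathsf a$ and has weight $c_{\mathsf a}$. The graph $\Gamma$ is $\Lambda$-periodic, and $\Gamma_N=\Gamma/N\Lambda$ is the finite quotient graph, with inherited weights. Closed paths: a closed path of length $2k$ on $\Gamma_N$ is a sequence of edges $(e_1,e_2,\ldots,e_{2k-1},e_{2k})$ such that for $i=1,\ldots,k$ the intersection $e_{2i-1}\cap e_{2i}$ contains a white vertex and $e_{2i}\cap e_{2i+1}$ contains a black vertex, where $e_{2k+1}=e_1$. The weight of such a path is the product of the weights of the edges $e_1,e_2,\ldots,e_{2k}$. $\Gamma_N(2k)$ denotes the set of closed paths of length $2k$ on $\Gamma_N$.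
   Formalization: The printed formula lacks a factor 1/k: the formal theorem has z^{-k}/k in place of z^{-k} (e.g. A={1,3}, c=1, N=1 gives B_1(z)=z-4, with 4^k closed paths of length 2k). The identity is stated for complex z with |z|>(sum of c_a)^2, convergence included. *)

(* Defs.v *)
From HB Require Import structures.
From mathcomp Require Import all_boot all_order all_algebra finmap.
From mathcomp Require Import complex.
From mathcomp Require Import all_classical all_reals all_analysis.

Set Implicit Arguments.
Unset Strict Implicit.
Unset Printing Implicit Defensive.

Import Order.TTheory GRing.Theory Num.Theory.
Import numFieldNormedType.Exports.

Local Open Scope classical_set_scope.
Local Open Scope ring_scope.
Local Open Scope complex_scope.

Section Lattices.

Definition translate (V : zmodType) (L : set V) (v : V) : set V :=
  [set v + l | l in L].

(* The image of [S] in the quotient [V / L]. *)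
Definition cosets (V : zmodType) (L S : set V) : set (set V) :=
  translate L @` S.

Definition Zfree (V : zmodType) (r : nat) (v : 'I_r -> V) : Prop :=
  forall m : 'I_r -> int, \sum_(i < r) v i *~ m i = 0 -> forall i, m i = 0.

Definition lattice_rank (V : zmodType) (L : set V) (r : nat) : Prop :=
  (exists v : 'I_r -> V, (forall i, L (v i)) /\ Zfree v) /\
  (forall s (v : 'I_s -> V), (forall i, L (v i)) -> Zfree v -> (s <= r)%N).

Variable n : nat.
Implicit Types A : {fset 'rV[int]_n}.

Definition diff_lattice A : set 'rV[int]_n :=
  [set v | inIntSpan (in_tuple [seq a - b | a <- A, b <- A]) v].

Variable R : realType.

Definition inner (t : 'rV[R]_n) (a : 'rV[int]_n) : R :=
  \sum_(i < n) t 0 i * (a 0 i)%:~R.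

Definition dual_lattice A : set 'rV[R]_n :=
  [set t | forall a b, a \in A -> b \in A -> inner t (a - b) \is a Num.int].

End Lattices.

Arguments dual_lattice {n} R A.

Section Diffraction.

Variables (R : realType) (n : nat) (A : {fset 'rV[int]_n}).
Variable c : 'rV[int]_n -> nat.

Definition cexp (w : R[i]) : R[i] :=
  (expR (complex.Re w))%:C * (cos (complex.Im w) +i* sin (complex.Im w)).

Definition Dhat (t : 'rV[R]_n) : R[i] :=
  \sum_(a <- A) (c a)%:R * cexp (0 -i* (2 * pi * inner t a)).

(* [|Dhat|^2] is constant on the cosets [C] of the dual lattice. *)
Definition mult (N : nat) (r : R) : nat :=
  #|` fset_set [set C | cosets (dual_lattice R A)
                          [set N%:R^-1 *: s | s in dual_lattice R A] C /\
                        forall t, C t -> `|Dhat t| ^+ 2 = r%:C] |%fset.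

Definition Bpoly (N : nat) : {poly R} :=
  \big[*%R/1]_(r \in [set: R]) ('X - r%:P) ^+ mult N r.

End Diffraction.

Arguments Bpoly R {n} A c N.

Section Graph.

Variables (n : nat) (A : {fset 'rV[int]_n}).

Local Notation vertex := 'rV[int]_n.
Local Notation Lambda := (diff_lattice A).

Definition black : set vertex := Lambda.

Definition white : set vertex :=
  [set v | exists a l, [/\ a \in A, Lambda l & v = a + l]].

(* Edges are pairs (tail, head); the type of [e] is [e.2 - e.1]. *)
Definition edge : set (vertex * vertex) :=
  [set e | [/\ black e.1, white e.2 & e.2 - e.1 \in A]].

Variable N : nat.

Definition NLambda : set vertex := [set l *+ N | l in Lambda].

Definition blackN : set (set vertex) := cosets NLambda black.

Definition whiteN : set (set vertex) := cosets NLambda white.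

(* An edge of the quotient graph is a whole [NLambda]-orbit of edges, so that
   edges of different types with the same end points remain different. *)
Definition edgeN : set (set (vertex * vertex)) :=
  [set E | exists2 e, edge e & E = [set (e.1 + l, e.2 + l) | l in NLambda]].

Definition ends (E : set (vertex * vertex)) : set (set vertex) :=
  [set fst @` E; snd @` E].

Definition meet_in (P : set (set vertex)) (E F : set (vertex * vertex)) : Prop :=
  (ends E `&` ends F `&` P) !=set0.

(* Closed paths of length [2k], with [e_1, ..., e_2k] stored at positions
   [0, ..., 2k-1]. A closed path comes with a first edge, so cyclic shifts
   count separately: the total weight is the trace of a [k]-th power, i.e. the
   [k]-th power sum of the roots of [Bpoly]. This is why [log (1 - r / z)]
   yields the coefficient [1 / k] in front of it. *)
Definition closed_paths (k : nat) :
    set ((k.*2).-tuple (set (vertex * vertex))) :=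
  [set g | (forall j, edgeN (tnth g j)) /\
    forall i, (i < k)%N ->
      meet_in whiteN (nth set0 g i.*2) (nth set0 g i.*2.+1) /\
      meet_in blackN (nth set0 g i.*2.+1) (nth set0 g (i.*2.+2 %% k.*2))].

Variable c : vertex -> nat.

(* All edges in an orbit have the same type. *)
Definition edge_weight (E : set (vertex * vertex)) : nat :=
  c (xget 0 [set e.2 - e.1 | e in E]).

Definition path_weight (k : nat) (g : k.-tuple (set (vertex * vertex))) : nat :=
  (\prod_(E <- g) edge_weight E)%N.

End Graph.

Arguments closed_paths {n} A N k.

(* Main.v *)
(* Write [L] for the difference lattice. The points [t] of order [N] modulo the
   dual lattice give all characters of [L / N L], so by orthogonality the sum
   over [t] of [|Dhat t|^(2k)], expanded as a sum over [k]-tuples of pairs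
   [(a_i, b_i)], keeps exactly [N^n] times the tuples for which
   [sum (a_i - b_i)] lies in [N L]. Such a tuple together with a black starting
   vertex is the same thing as a closed path of length [2k]. Hence the weighted
   number of closed paths is the [k]-th power sum of the roots of [Bpoly], and
   the theorem follows from [exp (- sum_k w^k / k) = 1 - w] at [w = root / z]. *)

Require Import Defs.
From HB Require Import structures.
From mathcomp Require Import all_boot all_order all_algebra finmap.
From mathcomp Require Import complex.
From mathcomp Require Import all_classical all_reals all_analysis.
From mathcomp Require Import ring lra.

Set Implicit Arguments.
Unset Strict Implicit.
Unset Printing Implicit Defensive.

Import Order.TTheory GRing.Theory Num.Theory.
Import numFieldNormedType.Exports.

Local Open Scope classical_set_scope.
Local Open Scope ring_scope.
Local Open Scope complex_scope.

(** * The logarithm series *)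

Section LogSeries.
Variable R : realType.

Lemma Re_mul (a b : R[i]) :
  complex.Re (a * b) =
  complex.Re a * complex.Re b - complex.Im a * complex.Im b.
Proof. by case: a b => [? ?] [? ?]. Qed.

Lemma Im_mul (a b : R[i]) :
  complex.Im (a * b) =
  complex.Re a * complex.Im b + complex.Im a * complex.Re b.
Proof. by case: a b => [? ?] [? ?]. Qed.

Lemma Re_sum (I : Type) (r : seq I) (P : pred I) (F : I -> R[i]) :
  complex.Re (\sum_(i <- r | P i) F i) = \sum_(i <- r | P i) complex.Re (F i).
Proof. by apply: (big_morph (@complex.Re R)) => // -[? ?] [? ?]. Qed.

Lemma Im_sum (I : Type) (r : seq I) (P : pred I) (F : I -> R[i]) :
  complex.Im (\sum_(i <- r | P i) F i) = \sum_(i <- r | P i) complex.Im (F i).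
Proof. by apply: (big_morph (@complex.Im R)) => // -[? ?] [? ?]. Qed.

Lemma normc_ge_Im (x : R[i]) : `|complex.Im x|%:C <= `|x|.
Proof.
have i1 : `|'i%C : R[i]| = 1.
  by rewrite normc_def /= expr0n expr1n add0r sqrtr1.
by rewrite -normrN -ReiNIm (le_trans (normc_ge_Re _))// normrM i1 mulr1.
Qed.

Lemma normc_le_ReIm (x : R[i]) :
  `|x| <= (`|complex.Re x| + `|complex.Im x|)%:C.
Proof.
rewrite {1}[x]complexE rmorphD /= (le_trans (ler_normD _ _)) // lerD //.
  by rewrite normc_def /= expr0n addr0 sqrtr_sqr.
by rewrite normrM !normc_def /= !expr0n /= addr0 add0r expr1n sqrtr1 mul1r
  sqrtr_sqr.
Qed.

Lemma cvg_complex (f : nat -> R[i]^o) (a b : R) :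
  complex.Re (f m) @[m --> \oo] --> a -> complex.Im (f m) @[m --> \oo] --> b ->
  f m @[m --> \oo] --> (a +i* b : R[i]^o).
Proof.
move=> /cvgrPdist_lt fa /cvgrPdist_lt fb; apply/cvgrPdist_lt => e e0.
have [d eE] : exists d : R, e = d%:C by exists (complex.Re e); rewrite RRe_real ?gtr0_real.
move: e0; rewrite {}eE ltcR => d0.
have d2 : 0 < d / 2 by rewrite divr_gt0.
near=> m; apply: (le_lt_trans (normc_le_ReIm _)); rewrite ltcR.
have -> : complex.Re (a +i* b - f m) = a - complex.Re (f m) by case: (f m).
have -> : complex.Im (a +i* b - f m) = b - complex.Im (f m) by case: (f m).
rewrite [ltRHS](splitr d) ltrD //.
- by near: m; exact: fa.
- by near: m; exact: fb.
Unshelve. all: by end_near. Qed.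

Lemma sum_nat_expr (q : R) n :
  (1 - q) ^+ 2 * \sum_(0 <= i < n) i.+1%:R * q ^+ i =
  1 - q ^+ n - n%:R * q ^+ n * (1 - q).
Proof.
elim: n => [|n IH]; first by rewrite big_geq // expr0 mulr0; ring.
by rewrite big_nat_recr //= mulrDr IH -!natr1 !exprS; ring.
Qed.

Lemma is_cvg_series_nat_expr (q : R) : 0 <= q -> q < 1 ->
  cvgn (series (fun i => i.+1%:R * q ^+ i)).
Proof.
move=> q0 q1; apply: nondecreasing_is_cvgn.
  by apply: nondecreasing_series => i _ _; rewrite mulr_ge0 ?exprn_ge0.
exists ((1 - q) ^- 2) => _ [n _ <-]; rewrite /series /=.
have q2 : 0 < (1 - q) ^+ 2 by rewrite exprn_gt0 // subr_gt0.
rewrite -(ler_pM2l q2) sum_nat_expr mulfV ?gt_eqF //.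
have : 0 <= n%:R * q ^+ n * (1 - q).
  by rewrite !mulr_ge0 ?exprn_ge0 // subr_ge0 ltW.
have := exprn_ge0 n q0; lra.
Qed.

Lemma is_cvg_pseries_le (f : R ^nat) (r K : R) : 0 <= r -> 0 <= K ->
  r * K < 1 -> (forall i, `|f i| <= i.+1%:R * r ^+ i) -> cvgn (pseries f K).
Proof.
move=> r0 K0 rK fr; apply: normed_cvg.
have rK0 : 0 <= r * K by rewrite mulr_ge0.
apply: (series_le_cvg _ _ _ (is_cvg_series_nat_expr rK0 rK)) => i //=.
  by rewrite mulr_ge0 ?exprn_ge0.
by rewrite normrM exprMn mulrA ler_pM // normrX ger0_norm.
Qed.

(* Along the ray [s |-> s w] the function [(1 - s w) exp (sum (s w)^k / k)] has
   vanishing derivative. *)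
Lemma cvg_log_series (w : R[i]) : `|w| < 1 ->
  exists2 L : R[i],
    (\sum_(1 <= k < m) w ^+ k / k%:R : R[i]^o) @[m --> \oo] --> (L : R[i]^o) &
    (1 - w) * cexp L = 1.
Proof.
move=> w1; pose r := complex.Re `|w|.
have wr : `|w| = r%:C by rewrite /r RRe_real // normr_real.
have r0 : 0 <= r by rewrite -ler0c -wr.
have r1 : r < 1 by rewrite -ltcR -wr.
have Rek k : `|complex.Re (w ^+ k)| <= r ^+ k.
  by rewrite -lecR (le_trans (normc_ge_Re _))// normrX wr rmorphXn.
have Imk k : `|complex.Im (w ^+ k)| <= r ^+ k.
  by rewrite -lecR (le_trans (normc_ge_Im _))// normrX wr rmorphXn.
have dominated (f : R ^nat) : (forall k, `|f k| <= r ^+ k) ->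
    let c k := f k / k%:R in
    [/\ forall k, `|c k| <= k.+1%:R * r ^+ k,
        forall k, pseries_diffs c k = f k.+1,
        forall k, `|pseries_diffs c k| <= k.+1%:R * r ^+ k &
        forall k, `|pseries_diffs (pseries_diffs c) k| <= k.+1%:R * r ^+ k].
  move=> fr c.
  have dc k : pseries_diffs c k = f k.+1.
    by rewrite /pseries_diffs /c mulrC divfK.
  have rS k : r ^+ k.+1 <= r ^+ k by rewrite exprS ler_piMl ?exprn_ge0 // ltW.
  split=> // k.
  - rewrite normrM normfV normr_nat; case: k => [|k].
      by rewrite invr0 mulr0 mul1r exprn_ge0.
    rewrite ler_pdivrMr // (le_trans (fr _)) //.
    rewrite mulrAC ler_peMl ?exprn_ge0 //.
    by rewrite -natrM ler1n.
  - rewrite dc (le_trans (fr _)) // (le_trans (rS _)) //.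
    by rewrite ler_peMl ?exprn_ge0 // ler1n.
  - rewrite /pseries_diffs -/(pseries_diffs c k.+1) dc normrM normr_nat.
    by rewrite ler_wpM2l // (le_trans (fr _)) // (le_trans (rS _)).
pose K := 2 / (1 + r).
have r10 : 0 < 1 + r by lra.
have K1 : 1 < K by rewrite /K ltr_pdivlMr //; lra.
have K0 : 0 <= K by rewrite (le_trans _ (ltW K1)).
have rK : r * K < 1 by rewrite /K mulrA ltr_pdivrMr //; lra.
have series_facts (f : R ^nat) : (forall k, `|f k| <= r ^+ k) ->
    let c k := f k / k%:R in
    (forall s : R, `|s| < K -> cvgn (pseries c s)) /\
    exists2 df : R -> R,
      forall s : R, `|s| < K -> is_derive s (1 : R) (fun s : R => limn (pseries c s)) (df s) &
      forall s : R, `|s| < K -> pseries (fun k => f k.+1) s m @[m --> \oo] --> df s.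
  move=> fr c; have [c0 dc c1 c2] := dominated f fr.
  have cv := is_cvg_pseries_le r0 K0 rK.
  have sK (s : R) : `|s| < K -> `|s| < `|K| by rewrite (ger0_norm K0).
  split=> [s /sK|]; first by apply: is_cvg_pseries_inside; exact: cv.
  exists (fun s => limn (pseries (pseries_diffs c) s)) => s /sK sK'.
    by apply: (pseries_snd_diffs (K := K)) => //; exact: cv.
  rewrite -(_ : pseries_diffs c = fun k => f k.+1); last exact/funext.
  by apply: is_cvg_pseries_inside sK'; exact: cv.
set x := complex.Re w; set y := complex.Im w.
have [ucv [U uU Ucv]] := series_facts _ Rek.
have [vcv [V vV Vcv]] := series_facts _ Imk.
set a := fun k => complex.Re (w ^+ k) / k%:R in ucv uU.
set b := fun k => complex.Im (w ^+ k) / k%:R in vcv vV.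
pose u (s : R) := limn (pseries a s); pose v (s : R) := limn (pseries b s).
have UE s : `|s| < K -> U s = x + s * (x * U s - y * V s).
  move=> sK; have := Ucv _ sK; rewrite -cvg_shiftS => Ucv1.
  apply: (cvg_unique _ Ucv1) => //.
  rewrite (_ : [sequence _]_n = fun m =>
      x + s * (x * pseries (fun k => complex.Re (w ^+ k.+1)) s m -
               y * pseries (fun k => complex.Im (w ^+ k.+1)) s m)).
    apply: cvgD; first exact: cvg_cst.
    apply: cvgMr; apply: cvgB; apply: cvgMr; [exact: Ucv|exact: Vcv].
  apply/funext => m; rewrite /pseries /series /= big_nat_recl //= expr0 mulr1.
  rewrite expr1 -/x !mulr_sumr -sumrB mulr_sumr; congr (_ + _).
  by apply: eq_bigr => i _; rewrite (exprS w) Re_mul (exprS s) -/x -/y; ring.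
have VE s : `|s| < K -> V s = y + s * (x * V s + y * U s).
  move=> sK; have := Vcv _ sK; rewrite -cvg_shiftS => Vcv1.
  apply: (cvg_unique _ Vcv1) => //.
  rewrite (_ : [sequence _]_n = fun m =>
      y + s * (x * pseries (fun k => complex.Im (w ^+ k.+1)) s m +
               y * pseries (fun k => complex.Re (w ^+ k.+1)) s m)).
    apply: cvgD; first exact: cvg_cst.
    apply: cvgMr; apply: cvgD; apply: cvgMr; [exact: Vcv|exact: Ucv].
  apply/funext => m; rewrite /pseries /series /= big_nat_recl //= expr0 mulr1.
  rewrite expr1 -/y !mulr_sumr -big_split /= mulr_sumr; congr (_ + _).
  by apply: eq_bigr => i _; rewrite (exprS w) Im_mul (exprS s) -/x -/y; ring.
pose H1 (s : R) := expR (u s) * ((1 - s * x) * cos (v s) + s * y * sin (v s)).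
pose H2 (s : R) := expR (u s) * ((1 - s * x) * sin (v s) - s * y * cos (v s)).
have dH1 s : `|s| < K -> is_derive s (1 : R) H1 0.
  move=> sK; have := uU _ sK; have := vV _ sK; rewrite -/(u _) -/(v _) => vs us.
  apply: (@is_derive_eq _ _ _ ((expR \o u) *
    ((cst 1 - id * cst x) * (cos \o v) + (id * cst y) * (sin \o v))) _ _ _ _ _).
  rewrite /= /GRing.scale /=.
  transitivity (expR (u s) * (cos (v s) * (U s - (x + s * (x * U s - y * V s)))
    - sin (v s) * (V s - (y + s * (x * V s + y * U s))))); last first.
    by rewrite -UE // -VE // !subrr !mulr0 subrr mulr0.
  rewrite !fctE /=.
  ring.
have dH2 s : `|s| < K -> is_derive s (1 : R) H2 0.
  move=> sK; have := uU _ sK; have := vV _ sK; rewrite -/(u _) -/(v _) => vs us.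
  apply: (@is_derive_eq _ _ _ ((expR \o u) *
    ((cst 1 - id * cst x) * (sin \o v) - (id * cst y) * (cos \o v))) _ _ _ _ _).
  rewrite /= /GRing.scale /=.
  transitivity (expR (u s) * (sin (v s) * (U s - (x + s * (x * U s - y * V s)))
    + cos (v s) * (V s - (y + s * (x * V s + y * U s))))); last first.
    by rewrite -UE // -VE // !subrr !mulr0 addr0 mulr0.
  rewrite !fctE /=.
  ring.
have const01 (H : R -> R) : (forall s : R, `|s| < K -> is_derive s (1 : R) H 0) -> H 1 = H 0.
  move=> dH; have := @MVT_segment _ H (fun=> 0) 0 1 ler01.
  case=> [s||s _]; last by move/eqP; rewrite mul0r subr_eq0 => /eqP.
    rewrite in_itv /= => /andP[s0 s1]; apply: dH.
    by rewrite gtr0_norm // (lt_trans s1).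
  apply: derivable_within_continuous => s.
  rewrite in_itv /= => /andP[s0 s1]; apply: (@ex_derive _ _ _ _ _ _ 0).
  by apply: dH; rewrite ger0_norm // (le_lt_trans s1).
have pseries0 c : c 0%N = 0 -> limn (pseries c 0) = 0 :> R.
  move=> c0; rewrite (_ : pseries c 0 = fun=> 0) ?lim_cst //.
  apply/funext => m; rewrite /pseries /series /= big1 // => -[|i] _.
    by rewrite c0 mul0r.
  by rewrite expr0n mulr0.
have u0 : u 0 = 0 by rewrite /u pseries0 // /a invr0 mulr0.
have v0 : v 0 = 0 by rewrite /v pseries0 // /b invr0 mulr0.
have := const01 _ dH1; have := const01 _ dH2.
rewrite /H1 /H2 u0 v0 expR0 cos0 sin0 !mul0r !mulr0 !mul1r !mulr1.
rewrite !subr0 !addr0 => H20 H10.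
exists (u 1 +i* v 1); last first.
  have wE : w = x +i* y by rewrite /x /y; case: (w).
  rewrite /cexp wE; apply/eqP; rewrite eq_complex /=.
  apply/andP; split; apply/eqP; [rewrite -[RHS]H10|rewrite -[RHS]H20]; ring.
have sum1 (c : nat -> R) m : c 0%N = 0 -> \sum_(1 <= k < m) c k = pseries c 1 m.
  move=> c0; rewrite /pseries /series /=.
  case: m => [|m]; first by rewrite !big_geq.
  rewrite [RHS]big_nat_recl // c0 mul0r add0r big_add1.
  by apply: eq_bigr => i _; rewrite expr1n mulr1.
have mulrn (z : R[i]) k : z / k%:R = (k%:R^-1)%:C * z.
  by rewrite mulrC fmorphV /= rmorph_nat.
apply: cvg_complex.
- rewrite (_ : (fun m => _) = pseries a 1); last first.
    apply/funext => m; rewrite -sum1 /a ?invr0 ?mulr0 // Re_sum.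
    by apply: eq_bigr => k _; rewrite mulrn Re_mul /= mul0r subr0 mulrC.
  by apply: ucv; rewrite normr1.
- rewrite (_ : (fun m => _) = pseries b 1); last first.
    apply/funext => m; rewrite -sum1 /b ?invr0 ?mulr0 // Im_sum.
    by apply: eq_bigr => k _; rewrite mulrn Im_mul /= mul0r addr0 mulrC.
  by apply: vcv; rewrite normr1.
Qed.

End LogSeries.

(** * Bases of the difference lattice *)

Section Basis.
Variables (n : nat) (A : {fset 'rV[int]_n}).

Lemma diff_lattice_basis : exists P : 'M[int]_n,
  diff_lattice A = [set y *m P | y in [set: 'rV_n]].
Proof.
rewrite /diff_lattice; set s := [seq _ | _ <- _, _ <- _]; set m := size s.
pose M : 'M[int]_(m, n) := \matrix_(i < m) s`_i.
have [L uL [Q uQ [d _ Md]]] := int_Smith_normal_form M.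
set D := \matrix_(i, j) _ in Md.
have spanE (a : int ^ m) : \sum_(i < m) s`_i *~ a i = (\row_i a i) *m M.
  apply/rowP => j; rewrite mxE summxE; apply: eq_bigr => i _.
  by rewrite -scaler_int intz !mxE.
pose e (i : 'I_n) : int := if (i < m)%N then d`_i else 0.
exists (diag_mx (\row_i e i) *m Q).
apply/seteqP; split => [v [a ->]|_ [y _ <-]] /=.
  rewrite spanE Md !mulmxA; set x := _ *m L.
  exists (\row_j \sum_(i < m) x 0 i *+ (i == j :> nat)) => //.
  rewrite mulmxA; congr (_ *m _); apply/rowP => j.
  rewrite mul_mx_diag !mxE mulr_suml; apply: eq_bigr => i _.
  rewrite [D i j]mxE /e; case: eqP => [<-|_]; last by rewrite !mulr0n mul0r mulr0.
  by rewrite !mulr1n ltn_ord.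
pose x : 'rV[int]_m := \row_i \sum_(j < n) y 0 j *+ (i == j :> nat).
exists [ffun i => (x *m invmx L) 0 i]; rewrite spanE Md !mulmxA.
rewrite (_ : (\row_i _) = x *m invmx L); last first.
  by apply/rowP => i; rewrite mxE ffunE.
rewrite mulmxKV //; congr (_ *m _); apply/rowP => j.
rewrite mul_mx_diag !mxE /e; case: ifPn => [jm|jm]; last first.
  rewrite mulr0 big1 // => i _; rewrite [D i j]mxE.
  case: eqP => [ij|_]; last by rewrite mulr0n mulr0.
  by rewrite -ij ltn_ord in jm.
rewrite (bigD1 (Ordinal jm)) //= big1 ?addr0 => [|i ij].
  rewrite !mxE eqxx mulr1n; congr (_ * _); rewrite (bigD1 j) //= eqxx big1 ?addr0 //.
  by move=> k kj; rewrite eq_sym (_ : (_ == _) = false) //; apply/negbTE.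
rewrite [D i j]mxE (_ : (_ == _) = false) ?mulr0n ?mulr0 //.
by apply/negbTE.
Qed.

Lemma det_basis_neq0 (P : 'M[int]_n) :
  diff_lattice A = [set y *m P | y in [set: 'rV_n]] ->
  lattice_rank (diff_lattice A) n -> \det P != 0.
Proof.
move=> AP [[v [Lv Fv]] _].
have /choice[y yP] : forall i, exists y, y *m P = v i.
  by move=> i; have := Lv i; rewrite AP => -[y _ yE]; exists y.
apply/eqP => detP0.
have /det0P[u u0 uV] : \det ((\matrix_i y i) *m P) == 0.
  by rewrite det_mulmx detP0 mulr0.
case/negP: u0; apply/eqP/rowP => i; rewrite mxE.
apply: (Fv (fun i => u 0 i)); rewrite -[RHS]uV; apply/rowP => j.
rewrite summxE [RHS]mxE; apply: eq_bigr => k _.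
rewrite -scaler_int intz mxE -yP !mxE; congr (_ * _).
by apply: eq_bigr => l _; rewrite !mxE.
Qed.
End Basis.

Lemma translate_eq (V : zmodType) (L : set V) (v w : V) :
  L 0 -> (forall x y, L x -> L y -> L (x - y)) ->
  translate L v = translate L w <-> L (v - w).
Proof.
move=> L0 LB; have LN x : L x -> L (- x) by move=> Lx; rewrite -sub0r; exact: LB.
have LD x y : L x -> L y -> L (x + y).
  by move=> Lx Ly; rewrite -[y]opprK; apply: LB => //; exact: LN.
split=> [vw|Lvw].
  have : translate L v v by exists 0 => //; rewrite addr0.
  by rewrite vw => -[l Ll <-]; rewrite addrAC subrr add0r.
apply/seteqP; split=> _ [l Ll <-].
  by exists (v - w + l); [exact: LD|rewrite addrA subrKC].
by exists (l - (v - w)); [exact: LB|rewrite addrA addrAC opprB subrKC addrC].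
Qed.

Section Residues.
Variables (n N : nat).
Hypothesis N_gt0 : (0 < N)%N.

Definition residue (x : {ffun 'I_n -> 'I_N}) : 'rV[int]_n := \row_i (x i)%:Z.

Lemma residue_exists (y : 'rV[int]_n) :
  exists x m, y = residue x + m *+ N.
Proof.
have modN (i : 'I_n) : (`|(y 0%R i %% N)%Z| < N)%N.
  have N0 : (N%:Z != 0) by rewrite -lt0n.
  by rewrite -ltz_nat gez0_abs ?modz_ge0 // ltz_pmod // ltz_nat.
exists [ffun i => Ordinal (modN i)], (\row_i (y 0%R i %/ N)%Z).
apply/rowP => i; rewrite !mxE ffunE /= gez0_abs; last by rewrite modz_ge0 // -lt0n.
by rewrite {1}(divz_eq (y 0 i) N) addrC mulmxnE !mxE -mulr_natr natz.
Qed.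

Lemma residue_inj (x x' : {ffun 'I_n -> 'I_N}) (m : 'rV[int]_n) :
  residue x - residue x' = m *+ N -> x = x'.
Proof.
move=> xx'; apply/ffunP => i; apply/val_inj.
have /rowP/(_ i) := xx'; rewrite mulmxnE !mxE => /eqP.
rewrite subr_eq -mulr_natr => /eqP/(congr1 (modz^~ N)).
by rewrite natz modzMDl !modz_nat !modn_small // => -[].
Qed.
End Residues.

(** * Closed paths *)

Lemma big_nat_double (R : Type) (idx : R) (op : Monoid.law idx) k (F : nat -> R) :
  \big[op/idx]_(0 <= j < k.*2) F j =
  \big[op/idx]_(0 <= i < k) op (F i.*2) (F i.*2.+1).
Proof.
elim: k => [|k IH]; first by rewrite !big_geq.
by rewrite doubleS !big_nat_recr //= IH Monoid.mulmA.
Qed.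

Section Paths.
Variables (n : nat) (A : {fset 'rV[int]_n}) (c : 'rV[int]_n -> nat).
Hypothesis A_Lambda : [set` A] `&` diff_lattice A = set0.
Variable P : 'M[int]_n.
Hypothesis AP : diff_lattice A = [set y *m P | y in [set: 'rV_n]].
Hypothesis detP : \det P != 0.
Variable N : nat.
Hypothesis N_gt0 : (0 < N)%N.

Local Notation V := 'rV[int]_n.
Local Notation Lambda := (diff_lattice A).
Local Notation NL := (NLambda A N).

Lemma Lambda0 : Lambda 0.
Proof. by rewrite AP; exists 0; rewrite ?mul0mx. Qed.

Lemma LambdaB u v : Lambda u -> Lambda v -> Lambda (u - v).
Proof.
by rewrite AP => -[y _ <-] [z _ <-]; exists (y - z); rewrite ?mulmxBl.
Qed.

Lemma LambdaD u v : Lambda u -> Lambda v -> Lambda (u + v).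
Proof.
by rewrite AP => -[y _ <-] [z _ <-]; exists (y + z); rewrite ?mulmxDl.
Qed.

Lemma Lambda_sub a b : a \in A -> b \in A -> Lambda (a - b).
Proof.
move=> aA bA; rewrite /diff_lattice /=; set s := [seq _ | _ <- _, _ <- _].
have abs : a - b \in s by apply/allpairsP; exists (a, b).
pose i := Ordinal (etrans (index_mem (a - b) s) abs).
exists [ffun j => (j == i)%:Z].
rewrite (bigD1 i) //= ffunE eqxx nth_index // big1 ?addr0 // => j ji.
by rewrite ffunE (negbTE ji).
Qed.

Lemma NLambdaP v : NL v <-> exists y, v = (y *m P) *+ N.
Proof.
rewrite /NLambda /= AP; split; first by case=> _ [y _ <-] <-; exists y.
by case=> y ->; exists (y *m P) => //; exists y.
Qed.

Lemma NLambda0 : NL 0.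
Proof. by apply/NLambdaP; exists 0; rewrite mul0mx mul0rn. Qed.

Lemma NLambdaB u v : NL u -> NL v -> NL (u - v).
Proof.
move=> /NLambdaP[y ->] /NLambdaP[z ->]; apply/NLambdaP; exists (y - z).
by rewrite mulmxBl mulrnBl.
Qed.

Lemma NLambdaN u : NL u -> NL (- u).
Proof. by move=> Lu; rewrite -sub0r; apply: NLambdaB => //; exact: NLambda0. Qed.

Lemma NLambdaD u v : NL u -> NL v -> NL (u + v).
Proof. by move=> Lu Lv; rewrite -[v]opprK; apply/NLambdaB/NLambdaN. Qed.

Lemma NLambda_sub : NL `<=` Lambda.
Proof.
move=> _ /NLambdaP[y ->]; rewrite AP; exists (y *+ N) => //.
by rewrite -!scaler_nat -scalemxAl.
Qed.

Lemma white_notin_Lambda v : white A v -> ~ Lambda v.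
Proof.
case=> a [l [aA Ll ->]] Lal; suff : ([set` A] `&` Lambda) a by rewrite A_Lambda.
by split=> //; rewrite -[a](addrK l); apply: LambdaB.
Qed.

Definition edge_orbit (e : V * V) : set (V * V) :=
  [set (e.1 + l, e.2 + l) | l in NL].

Lemma edge_orbit_fst e : fst @` edge_orbit e = translate NL e.1.
Proof.
apply/seteqP; split=> [_ [_ [l Ll <-] <-]|_ [l Ll <-]] /=; first by exists l.
by exists (e.1 + l, e.2 + l) => //; exists l.
Qed.

Lemma edge_orbit_snd e : snd @` edge_orbit e = translate NL e.2.
Proof.
apply/seteqP; split=> [_ [_ [l Ll <-] <-]|_ [l Ll <-]] /=; first by exists l.
by exists (e.1 + l, e.2 + l) => //; exists l.
Qed.

Lemma edge_orbit_type e : [set e'.2 - e'.1 | e' in edge_orbit e] = [set e.2 - e.1].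
Proof.
apply/seteqP; split=> [_ [_ [l Ll <-] <-]|_ ->] /=.
  by rewrite opprD addrACA subrr addr0.
by exists e => //; exists 0; [exact: NLambda0|rewrite !addr0; case: (e)].
Qed.

Lemma edge_weight_orbit e : edge_weight c (edge_orbit e) = c (e.2 - e.1).
Proof.
rewrite /edge_weight edge_orbit_type; congr c.
by have := @xgetPex _ (0 : V) [set e.2 - e.1] (ex_intro _ _ erefl).
Qed.

Lemma edge_orbit_eq e e' :
  edge_orbit e = edge_orbit e' <-> NL (e.1 - e'.1) /\ e.2 - e.1 = e'.2 - e'.1.
Proof.
split=> [ee'|[Le ee']].
  split; last first.
    have : [set e.2 - e.1] (e.2 - e.1) by [].
    by rewrite -edge_orbit_type ee' edge_orbit_type.
  have := edge_orbit_fst e; rewrite ee' edge_orbit_fst => /esym.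
  by move/(translate_eq _ _ NLambda0 NLambdaB).
have e2 : e.2 = e'.2 + (e.1 - e'.1).
  by rewrite -[e.2](subrK e.1) ee'; apply/rowP => i; rewrite !mxE; ring.
apply/seteqP; split=> _ [l Ll <-].
  exists (e.1 - e'.1 + l); first exact: NLambdaD.
  by congr pair; rewrite ?e2; apply/rowP => i; rewrite !mxE; ring.
exists (l - (e.1 - e'.1)); first exact: NLambdaB.
by congr pair; rewrite ?e2; apply/rowP => i; rewrite !mxE; ring.
Qed.

Lemma meet_white e e' : edge A e -> edge A e' ->
  meet_in (whiteN A N) (edge_orbit e) (edge_orbit e') <-> NL (e.2 - e'.2).
Proof.
have T := translate_eq _ _ NLambda0 NLambdaB.
have white_end x : edge A x -> forall X, whiteN A N X -> ends (edge_orbit x) X ->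
    X = translate NL x.2.
  move=> [bx wx _] _ [w ww <-] []; rewrite ?edge_orbit_fst ?edge_orbit_snd //.
  move=> /T /NLambda_sub wx1; case: (white_notin_Lambda ww).
  by rewrite -[w](subrK x.1); apply: LambdaD.
move=> ee ee'; split=> [[X [[Xe Xe'] Xw]]|L].
  by apply/T; rewrite -(white_end _ ee _ Xw Xe) (white_end _ ee' _ Xw Xe').
exists (translate NL e.2); split; last by exists e.2 => //; case: ee.
split; first by right; rewrite edge_orbit_snd.
by right; rewrite edge_orbit_snd; apply/T.
Qed.

Lemma meet_black e e' : edge A e -> edge A e' ->
  meet_in (blackN A N) (edge_orbit e) (edge_orbit e') <-> NL (e.1 - e'.1).
Proof.
have T := translate_eq _ _ NLambda0 NLambdaB.
have black_end x : edge A x -> forall X, blackN A N X -> ends (edge_orbit x) X ->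
    X = translate NL x.1.
  move=> [bx wx _] _ [w bw <-] []; rewrite ?edge_orbit_fst ?edge_orbit_snd //.
  move=> /esym/T /NLambda_sub wx1; case: (white_notin_Lambda wx).
  by rewrite -[x.2](subrK w); apply: LambdaD.
move=> ee ee'; split=> [[X [[Xe Xe'] Xb]]|L].
  by apply/T; rewrite -(black_end _ ee _ Xb Xe) (black_end _ ee' _ Xb Xe').
exists (translate NL e.1); split; last by exists e.1 => //; case: ee.
split; first by left; rewrite edge_orbit_fst.
by left; rewrite edge_orbit_fst; apply/T.
Qed.

Variable k : nat.
Implicit Types (x : {ffun 'I_n -> 'I_N}) (f : {ffun 'I_k -> A * A}).

Definition step f (j : nat) : V :=
  oapp (fun i => if odd j then val (f i).2 else val (f i).1) 0 (insub j./2).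

(* The black end of edge [j]: even edges lead from black to white and odd ones
   back to black. *)
Definition tail x f (j : nat) : V :=
  residue x *m P + \sum_(0 <= i < j.+1./2) (step f i.*2 - step f i.*2.+1).

Definition path_edge x f (j : nat) : V * V := (tail x f j, tail x f j + step f j).

Definition path_of (u : {ffun 'I_n -> 'I_N} * {ffun 'I_k -> A * A}) :
    (k.*2).-tuple (set (V * V)) :=
  [tuple edge_orbit (path_edge u.1 u.2 j) | j < k.*2].

Definition closes f : Prop :=
  NL (\sum_(i < k) (val (f i).1 - val (f i).2)).

Lemma step_even f (i : 'I_k) : step f i.*2 = val (f i).1.
Proof.
rewrite /step odd_double doubleK insubT //= => lik.
by congr (val (f _).1); apply: val_inj.
Qed.

Lemma step_odd f (i : 'I_k) : step f i.*2.+1 = val (f i).2.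
Proof.
rewrite /step /= odd_double /= uphalf_double insubT //= => lik.
by congr (val (f _).2); apply: val_inj.
Qed.

Lemma double_split j : (j < k.*2)%N ->
  exists i : 'I_k, j = i.*2 \/ j = i.*2.+1.
Proof.
move=> jk; have ik : (j./2 < k)%N by rewrite ltn_half_double.
exists (Ordinal ik) => /=; rewrite -{1 3}(odd_double_half j).
by case: odd; [right|left].
Qed.

Lemma step_in f j : (j < k.*2)%N -> step f j \in A.
Proof.
by move=> /double_split[i [->|->]]; rewrite ?step_even ?step_odd; exact: valP.
Qed.

Lemma tail0 x f : tail x f 0 = residue x *m P.
Proof. by rewrite /tail big_geq // addr0. Qed.

Lemma tail_odd x f i :
  tail x f i.*2.+1 = tail x f i.*2 + step f i.*2 - step f i.*2.+1.
Proof.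
by rewrite /tail /= uphalf_double doubleK big_nat_recr //= !addrA.
Qed.

Lemma tail_even x f i : tail x f i.+1.*2 = tail x f i.*2.+1.
Proof. by rewrite /tail /= !uphalf_double doubleK. Qed.

Lemma tail_end x f : tail x f k.*2 =
  residue x *m P + \sum_(i < k) (val (f i).1 - val (f i).2).
Proof.
rewrite /tail /= uphalf_double big_mkord; congr (_ + _).
by apply: eq_bigr => i _; rewrite step_even step_odd.
Qed.

Lemma tail_in_Lambda x f j : (j < k.*2)%N -> Lambda (tail x f j).
Proof.
move=> jk; apply: LambdaD; first by rewrite AP; exists (residue x).
rewrite big_nat_cond; apply: (big_ind Lambda).
- exact: Lambda0.
- exact: LambdaD.
move=> i; rewrite andbT => /andP[_ ij].
have ik : (i < k)%N.
  by rewrite (leq_trans ij) // -(doubleK k) half_leq.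
rewrite (step_even f (Ordinal ik)) (step_odd f (Ordinal ik)).
by apply: Lambda_sub; exact: valP.
Qed.

Lemma path_edgeP x f j : (j < k.*2)%N -> edge A (path_edge x f j).
Proof.
move=> jk; have aA := step_in f jk; have tL := tail_in_Lambda x f jk.
split=> //=; last by rewrite addrAC subrr add0r.
by exists (step f j), (tail x f j); rewrite addrC.
Qed.

Lemma path_weight_of u :
  path_weight c (path_of u) = (\prod_(i < k) (c (val (u.2 i).1) * c (val (u.2 i).2)))%N.
Proof.
rewrite /path_weight big_tuple.
transitivity (\prod_(0 <= j < k.*2) c (step u.2 j))%N.
  rewrite big_mkord; apply: eq_bigr => j _.
  by rewrite tnth_mktuple edge_weight_orbit /= addrAC subrr add0r.
rewrite big_nat_double big_mkord; apply: eq_bigr => i _ /=.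
by rewrite step_even step_odd.
Qed.

Hypothesis k_gt0 : (0 < k)%N.

Lemma path_of_inj : injective path_of.
Proof.
move=> [x f] [x' f'] ff'.
have eqj j : (j < k.*2)%N ->
    NL (tail x f j - tail x' f' j) /\ step f j = step f' j.
  move=> jk; have := congr1 (fun g => tnth g (Ordinal jk)) ff'.
  rewrite !tnth_mktuple /= => /edge_orbit_eq[/= Nt].
  by rewrite !(addrAC _ (step _ _)) !subrr !add0r.
have k2 : (0 < k.*2)%N by rewrite double_gt0.
have [] := eqj _ k2; rewrite !tail0 -mulmxBl => /NLambdaP[y].
rewrite -scaler_nat scalemxAl scaler_nat => xx' _.
congr pair.
  apply: (@residue_inj _ _ _ _ y); apply/eqP; rewrite -subr_eq0.
  apply: contraNT detP => xx'0; apply/det0P; exists (residue x - residue x' - y *+ N) => //.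
  by rewrite mulmxBl xx' subrr.
apply/ffunP => i; rewrite [LHS]surjective_pairing [RHS]surjective_pairing.
congr pair; apply: val_inj; rewrite -?step_even -?step_odd.
  by apply: (eqj _ _).2; rewrite ltn_double.
by apply: (eqj _ _).2; rewrite ltn_Sdouble.
Qed.

Lemma path_of_closed u : closes u.2 -> closed_paths A N k (path_of u).
Proof.
case: u => x f /= cf.
have nthE j : (j < k.*2)%N ->
    nth set0 (path_of (x, f)) j = edge_orbit (path_edge x f j).
  by move=> jk; rewrite -(tnth_nth _ _ (Ordinal jk)) tnth_mktuple.
split=> [j|i ik].
  by rewrite tnth_mktuple; exists (path_edge x f j) => //; exact: path_edgeP.
have i2 : (i.*2 < k.*2)%N by rewrite ltn_double.
have i21 : (i.*2.+1 < k.*2)%N by rewrite ltn_Sdouble.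
have i22 : (i.*2.+2 %% k.*2 < k.*2)%N by rewrite ltn_pmod // double_gt0.
rewrite !nthE //; split.
  apply/meet_white; [exact: path_edgeP..|rewrite /= tail_odd subrK subrr].
  exact: NLambda0.
apply/meet_black; [exact: path_edgeP..|rewrite /= -tail_even].
have [ik1|ik1] := ltnP i.+1 k.
  by rewrite -doubleS modn_small ?ltn_double // subrr; exact: NLambda0.
have {ik1} ik1 : i.+1 = k by apply/eqP; rewrite eqn_leq ik.
by rewrite -doubleS ik1 modnn tail0 tail_end addrAC subrr add0r.
Qed.

Lemma closed_path_exists g : closed_paths A N k g ->
  exists2 u, closes u.2 & path_of u = g.
Proof.
case=> edges meets.
have /choice[e0 e0P] : forall j, exists e, edge A e /\ tnth g j = edge_orbit e.
  by move=> j; have [e ee ->] := edges j; exists e.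
pose e j := oapp e0 0 (insub j).
have eP j : (j < k.*2)%N -> edge A (e j) /\ nth set0 g j = edge_orbit (e j).
  move=> jk; rewrite /e insubT /=; have [ee <-] := e0P (Sub j jk).
  by split=> //; rewrite (tnth_nth set0).
have e_in j : (j < k.*2)%N -> (e j).2 - (e j).1 \in A.
  by move=> /eP[[]].
have i2 (i : 'I_k) : (i.*2 < k.*2)%N by rewrite ltn_double.
have i21 (i : 'I_k) : (i.*2.+1 < k.*2)%N by rewrite ltn_Sdouble.
pose f : {ffun 'I_k -> A * A} := [ffun i => ([` e_in _ (i2 i)], [` e_in _ (i21 i)])%fset].
have stepE j : (j < k.*2)%N -> step f j = (e j).2 - (e j).1.
  by move=> /double_split[i [->|->]]; rewrite ?step_even ?step_odd ffunE.
have k2 : (0 < k.*2)%N by rewrite double_gt0.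
have [[b0 _ _] _] := eP _ k2; move: b0; rewrite /black AP => -[y _ yE].
have [x [m xm]] := residue_exists N_gt0 y.
have start : NL ((e 0).1 - tail x f 0).
  rewrite tail0 -yE -mulmxBl xm addrAC subrr add0r; apply/NLambdaP; exists m.
  by rewrite -scaler_nat -scalemxAl scaler_nat.
have white_step i : (i < k)%N -> NL ((e i.*2).1 - tail x f i.*2) ->
    NL ((e i.*2.+1).1 - tail x f i.*2.+1).
  move=> ik L; have [+ _] := meets i ik.
  have [ee0 ->] := eP _ (i2 (Ordinal ik)); have [ee1 ->] := eP _ (i21 (Ordinal ik)).
  rewrite meet_white //= => L'; rewrite tail_odd !stepE ?(i2 (Ordinal ik)) ?(i21 (Ordinal ik)) //.
  rewrite (_ : _ - _ = (e i.*2).1 - tail x f i.*2 - ((e i.*2).2 - (e i.*2.+1).2)).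
    exact: NLambdaB.
  by apply/rowP => l; rewrite !mxE; ring.
have even_step i : (i < k)%N -> NL ((e i.*2).1 - tail x f i.*2).
  elim: i => [//|i IH] ik; have ik' := ltnW ik.
  have L := white_step _ ik' (IH ik').
  have [_ +] := meets i ik'; rewrite -doubleS modn_small ?ltn_double //.
  have [ee0 ->] := eP _ (i2 (Ordinal ik)); have [ee1 ->] := eP _ (i21 (Ordinal ik')).
  rewrite meet_black //= => L'; rewrite tail_even.
  rewrite (_ : _ - _ = (e i.*2.+1).1 - tail x f i.*2.+1 - ((e i.*2.+1).1 - (e i.+1.*2).1)).
    exact: NLambdaB.
  by apply/rowP => l; rewrite !mxE; ring.
exists (x, f) => /=.
  have [i iE] : exists i, i.+1 = k by exists k.-1; rewrite prednK.
  have ik : (i < k)%N by rewrite -iE.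
  have L := white_step _ ik (even_step _ ik).
  have [_ +] := meets i ik; rewrite -doubleS {1}iE modnn.
  have [ee0 ->] := eP _ k2; have [ee1 ->] := eP _ (i21 (Ordinal ik)).
  rewrite meet_black //= => L'.
  have := tail_end x f; rewrite -{1}iE tail_even => tE.
  rewrite tail0 in start; rewrite /closes.
  rewrite (_ : \sum_(_ < _) _ = (e 0).1 - residue x *m P +
      ((e i.*2.+1).1 - (e 0).1) - ((e i.*2.+1).1 - tail x f i.*2.+1)).
    by apply: NLambdaB => //; apply: NLambdaD.
  by rewrite tE; apply/rowP => l; rewrite !mxE; ring.
apply: eq_from_tnth => j; rewrite tnth_mktuple (tnth_nth set0).
have [ee ->] := eP _ (ltn_ord j); apply/edge_orbit_eq => /=.
split; last by rewrite stepE ?ltn_ord // addrAC subrr add0r.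
rewrite -opprB; apply: NLambdaN.
have [i [->|->]] := double_split (ltn_ord j); first exact: even_step.
by apply: white_step => //; exact: even_step.
Qed.

Lemma sum_closed_paths (S : nmodType) (F : nat -> S) :
  \sum_(g \in closed_paths A N k) F (path_weight c g) =
  (\sum_(f | `[< closes f >])
     F (\prod_(i < k) (c (val (f i).1) * c (val (f i).2)))%N) *+ (N ^ n).
Proof.
rewrite (@reindex_fsbig _ _ _ _ _ path_of [set` [pred u | `[< closes u.2 >]]]).
  rewrite -(bigfs _ (index_enum_uniq _)); last by move=> u _; rewrite mem_index_enum.
  rewrite -(pair_big_dep xpredT (fun _ f => `[< closes f >])
    (fun x f => F (path_weight c (path_of (x, f))))) /=.
  under eq_bigr do under eq_bigr do rewrite path_weight_of /=.
  by rewrite sumr_const card_ffun !card_ord.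
split.
- by move=> u /= /asboolP; exact: path_of_closed.
- by move=> u v _ _; exact: path_of_inj.
- move=> g /closed_path_exists[u cu <-]; exists u => //=.
  exact/asboolP.
Qed.

End Paths.

(** * Characters and the roots of the diffraction polynomial *)

Section Characters.
Variable R : realType.

Lemma cexpD (a b : R[i]) : cexp (a + b) = cexp a * cexp b.
Proof.
case: a b => [a1 a2] [b1 b2]; rewrite /cexp /= expRD cosD sinD.
by apply/eqP; rewrite eq_complex /=; apply/andP; split; apply/eqP; ring.
Qed.

Lemma cexp0 : cexp (0 : R[i]) = 1.
Proof. by rewrite /cexp /= expR0 cos0 sin0 mul1r. Qed.

Lemma cexp_sum (I : Type) (r : seq I) (P : pred I) (F : I -> R[i]) :
  cexp (\sum_(i <- r | P i) F i) = \prod_(i <- r | P i) cexp (F i).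
Proof. exact: (big_morph _ cexpD cexp0). Qed.

(* [expi x = e^(-2 pi i x)] *)
Definition expi (x : R) : R[i] := cexp (0 -i* (2 * pi * x)).

Lemma expiD x y : expi (x + y) = expi x * expi y.
Proof.
rewrite /expi -cexpD; congr cexp.
by apply/eqP; rewrite eq_complex /= addr0 eqxx /=; apply/eqP; ring.
Qed.

Lemma expi0 : expi 0 = 1.
Proof. by rewrite /expi mulr0 oppr0 cexp0. Qed.

Lemma expiN x : expi (- x) = (expi x)^*.
Proof.
rewrite /expi /cexp /= mulrN opprK cosN sinN.
by apply/eqP; rewrite eq_complex /= !mul0r; apply/andP; split; apply/eqP; ring.
Qed.

Lemma expi_sum (I : Type) (r : seq I) (P : pred I) (F : I -> R) :
  expi (\sum_(i <- r | P i) F i) = \prod_(i <- r | P i) expi (F i).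
Proof. exact: (big_morph _ expiD expi0). Qed.

Lemma expi_mulrn x m : expi (x *+ m) = expi x ^+ m.
Proof. by elim: m => [|m IH]; rewrite ?expi0 // mulrS expiD IH exprS. Qed.

Lemma expi1 : expi 1 = 1.
Proof.
rewrite /expi /cexp /= expR0 mulr1 mul1r cosN sinN mulr_natl cos2pi.
by rewrite -[pi *+ 2]add0r sinD2pi sin0 oppr0.
Qed.

Lemma expi_int (m : int) : expi m%:~R = 1.
Proof.
case: m => m; first by rewrite -pmulrn expi_mulrn expi1 expr1n.
by rewrite NegzE mulrNz expiN -pmulrn expi_mulrn expi1 expr1n conjc1.
Qed.

Lemma expi_eq1 (x : R) : 0 <= x -> x < 1 -> expi x = 1 -> x = 0.
Proof.
rewrite le_eqVlt => /orP[/eqP-> //|x0] x1.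
have s0 : 0 < sin (pi * x).
  by rewrite sin_gt0_pi // mulr_gt0 ?pi_gt0 //= gtr_pMr ?pi_gt0.
rewrite /expi /cexp => /(congr1 (@complex.Re R)) /=.
rewrite expR0 mul0r subr0 mul1r cosN -mulrA mulr_natl cos_mulr2n cos2sin2.
move=> h; suff : sin (pi * x) ^+ 2 = 0.
  by move/eqP; rewrite sqrf_eq0 gt_eqF.
by move: h; rewrite mulr2n; lra.
Qed.

Lemma sum_expi (N : nat) (m : int) : (0 < N)%N ->
  \sum_(i < N) expi (m%:~R / N%:R * i%:R) = if (N %| m)%Z then N%:R else 0.
Proof.
move=> N0; have N0R : N%:R != 0 :> R by rewrite pnatr_eq0 -lt0n.
under eq_bigr do rewrite mulr_natr expi_mulrn.
set w := expi _; have wN : w ^+ N = 1.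
  by rewrite -expi_mulrn -(mulr_natr (_ / _)) divfK // expi_int.
case: ifPn => [/dvdzP[q mE]|Nm].
  have -> : w = 1 by rewrite /w mE intrM -pmulrn mulfK // expi_int.
  by under eq_bigr do rewrite expr1n; rewrite sumr_const card_ord.
have w1 : w != 1.
  apply: contra Nm => /eqP; rewrite /w {1}(divz_eq m N) intrD intrM.
  rewrite -(pmulrn _ N) mulrDl mulfK // expiD expi_int mul1r => w1.
  have NZ : (N%:Z != 0) by rewrite -lt0n.
  have := expi_eq1 _ _ w1.
  rewrite divr_ge0 ?ler0n ?ler0z ?modz_ge0 //.
  rewrite ltr_pdivrMr ?ltr0n // mul1r -[N%:R]/(N%:Z%:~R) ltr_int ltz_pmod //.
  move=> /(_ isT isT)/eqP; rewrite mulf_eq0 invr_eq0 (negbTE N0R) orbF intr_eq0.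
  by move=> /eqP m0; apply/dvdz_mod0P.
apply: (mulfI (_ : w - 1 != 0)); first by rewrite subr_eq0.
by rewrite -subrX1 wN subrr mulr0.
Qed.

End Characters.

Section Spectrum.
Variables (R : realType) (n : nat) (A : {fset 'rV[int]_n}).
Variables (c : 'rV[int]_n -> nat) (P : 'M[int]_n).
Hypothesis AP : diff_lattice A = [set y *m P | y in [set: 'rV_n]].
Hypothesis detP : \det P != 0.

Local Notation V := 'rV[int]_n.
Local Notation Lambda := (diff_lattice A).
Local Notation dual := (dual_lattice R A).

Lemma innerDr (t : 'rV[R]_n) (a b : V) : inner t (a + b) = inner t a + inner t b.
Proof.
by rewrite /inner -big_split /=; apply: eq_bigr => i _; rewrite mxE intrD mulrDr.
Qed.

Lemma innerNr (t : 'rV[R]_n) (a : V) : inner t (- a) = - inner t a.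
Proof.
by rewrite /inner -sumrN; apply: eq_bigr => i _; rewrite mxE intrN mulrN.
Qed.

Lemma innerDl (t s : 'rV[R]_n) (a : V) : inner (t + s) a = inner t a + inner s a.
Proof.
by rewrite /inner -big_split /=; apply: eq_bigr => i _; rewrite mxE mulrDl.
Qed.

Lemma inner_suml (I : Type) (r : seq I) (Q : pred I) (t : 'rV[R]_n) (F : I -> V) :
  inner t (\sum_(i <- r | Q i) F i) = \sum_(i <- r | Q i) inner t (F i).
Proof.
apply: (big_morph _ (innerDr t)).
by rewrite /inner big1 // => i _; rewrite mxE mulr0.
Qed.

(* Coordinates of [t] in the basis dual to the rows of [P]. *)
Definition dual_coord (t : 'rV[R]_n) : 'rV[R]_n := t *m (map_mx intr P)^T.

Lemma inner_mulmx (t : 'rV[R]_n) (y : V) :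
  inner t (y *m P) = \sum_j dual_coord t 0 j * (y 0 j)%:~R.
Proof.
rewrite /inner /dual_coord.
under eq_bigr do rewrite mxE rmorph_sum mulr_sumr /=.
rewrite exchange_big; apply: eq_bigr => j _.
rewrite mxE mulr_suml; apply: eq_bigr => i _; rewrite !mxE intrM; ring.
Qed.

Lemma dual_latticeP (t : 'rV[R]_n) :
  dual t <-> exists z : V, dual_coord t = map_mx intr z.
Proof.
split=> [dt|[z tz] a b aA bA]; last first.
  have := Lambda_sub aA bA; rewrite AP => -[y _ <-].
  rewrite inner_mulmx tz rpred_sum // => j _.
  by rewrite mxE -intrM intr_int.
have Lt v : Lambda v -> inner t v \is a Num.int.
  move=> [a ->]; rewrite inner_suml rpred_sum // => i _.
  have /allpairsP[[u w] /= [uA wA ->]] := mem_nth 0 (ltn_ord i).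
  rewrite (_ : inner t _ = inner t (u - w) * (a i)%:~R).
    by rewrite rpredM ?intr_int // dt.
  rewrite /inner mulr_suml; apply: eq_bigr => l _.
  by rewrite -(scaler_int (a i) (u - w)) intz mxE intrM; ring.
have tj j : dual_coord t 0 j \is a Num.int.
  have := Lt (delta_mx 0 j *m P); rewrite AP inner_mulmx.
  rewrite (bigD1 j) //= big1 => [|i ij].
    by rewrite [delta_mx _ _ _ _]mxE !eqxx mulr1 addr0; apply; exists (delta_mx 0 j).
  by rewrite [delta_mx _ _ _ _]mxE (negbTE ij) andbF mulr0.
exists (\row_j Num.floor (dual_coord t 0 j)); apply/rowP => j.
by rewrite [RHS]mxE [in RHS]mxE floorK ?tj.
Qed.

Variable N : nat.
Hypothesis N_gt0 : (0 < N)%N.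

Definition torsion_pt (y : {ffun 'I_n -> 'I_N}) : 'rV[R]_n :=
  N%:R^-1 *: (map_mx intr (residue y) *m invmx (map_mx intr P)^T).

Lemma unitP : (map_mx intr P)^T \in @unitmx R n.
Proof. by rewrite unitmx_tr unitmxE det_map_mx unitfE intr_eq0. Qed.

Lemma dual_coord_torsion y :
  dual_coord (torsion_pt y) = N%:R^-1 *: map_mx intr (residue y).
Proof. by rewrite /dual_coord -scalemxAl mulmxKV // unitP. Qed.

Lemma dual_coordB t s : dual_coord (t - s) = dual_coord t - dual_coord s.
Proof. exact: mulmxBl. Qed.

Lemma dual0 : dual 0.
Proof. by apply/dual_latticeP; exists 0; rewrite /dual_coord mul0mx map_mx0. Qed.

Lemma dualB t s : dual t -> dual s -> dual (t - s).
Proof.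
move=> /dual_latticeP[z tz] /dual_latticeP[w sw]; apply/dual_latticeP.
by exists (z - w); rewrite dual_coordB tz sw map_mxB.
Qed.

Lemma intr_mxMn (m : V) : map_mx intr (m *+ N) = N%:R *: map_mx intr m :> 'rV[R]_n.
Proof. by apply/rowP => i; rewrite !mxE mulmxnE rmorphMn mulr_natl. Qed.

Lemma torsion_ptP (t : 'rV[R]_n) : dual t ->
  exists y, dual (N%:R^-1 *: t - torsion_pt y).
Proof.
move=> /dual_latticeP[z tz]; have [y [m zE]] := residue_exists N_gt0 z.
have N0 : N%:R != 0 :> R by rewrite pnatr_eq0 -lt0n.
exists y; apply/dual_latticeP; exists m.
rewrite dual_coordB dual_coord_torsion {1}/dual_coord -scalemxAl -/(dual_coord t).
rewrite tz zE map_mxD addrC scalerDr addKr intr_mxMn scalerA mulVf //.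
by rewrite scale1r.
Qed.

Lemma torsion_pt_inj y y' : dual (torsion_pt y - torsion_pt y') -> y = y'.
Proof.
have N0 : N%:R != 0 :> R by rewrite pnatr_eq0 -lt0n.
move=> /dual_latticeP[m]; rewrite dual_coordB !dual_coord_torsion -scalerBr => yy'.
apply: (@residue_inj _ _ _ _ m).
have : map_mx intr (residue y - residue y') = map_mx intr (m *+ N) :> 'rV[R]_n.
  by rewrite map_mxB intr_mxMn -yy' scalerA mulfV // scale1r.
move=> /matrixP eq_intr; apply/matrixP => i j; apply: (@intr_inj R).
by have := eq_intr i j; rewrite !mxE.
Qed.

Lemma torsion_pt_dual y : dual (N%:R *: torsion_pt y).
Proof.
have N0 : N%:R != 0 :> R by rewrite pnatr_eq0 -lt0n.
apply/dual_latticeP; exists (residue y).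
by rewrite /dual_coord -scalemxAl -/(dual_coord _) dual_coord_torsion scalerA mulfV // scale1r.
Qed.

Lemma sqr_normDhat (t : 'rV[R]_n) : `|Dhat A c t| ^+ 2 =
  \sum_(p : A * A) (c (val p.1) * c (val p.2))%N%:R * expi (inner t (val p.1 - val p.2)).
Proof.
have DE : Dhat A c t = \sum_(a : A) (c (val a))%:R * expi (inner t (val a)).
  by rewrite /Dhat big_seq_fsetE.
have DcE : (Dhat A c t)^*%C =
    \sum_(a : A) (c (val a))%:R * expi (- inner t (val a)).
  rewrite DE rmorph_sum; apply: eq_bigr => a _; rewrite expiN rmorphM.
  by congr (_ * _); exact: conjc_nat.
rewrite sqr_normc DcE DE big_distrlr pair_big; apply: eq_bigr => -[a b] _ /=.
by rewrite innerDr innerNr expiD natrM mulrACA.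
Qed.

Lemma sqr_normDhat_periodic t s : dual s ->
  `|Dhat A c (t + s)| ^+ 2 = `|Dhat A c t| ^+ 2.
Proof.
move=> ds; rewrite !sqr_normDhat; apply: eq_bigr => -[a b] _ /=.
have /intrP[m sm] := ds _ _ (valP a) (valP b).
by rewrite innerDl expiD sm expi_int mulr1.
Qed.

Lemma sum_torsion_expi (l : V) : Lambda l ->
  \sum_y expi (inner (torsion_pt y) l) =
  if `[< NLambda A N l >] then (N ^ n)%N%:R else 0.
Proof.
rewrite AP => -[m _ <-].
have -> : \sum_y expi (inner (torsion_pt y) (m *m P)) =
    \sum_(y : {ffun 'I_n -> 'I_N}) \prod_j expi ((m 0 j)%:~R / N%:R * (y j)%:R).
  apply: eq_bigr => y _; rewrite inner_mulmx expi_sum; apply: eq_bigr => j _.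
  rewrite dual_coord_torsion !mxE -pmulrn; congr expi; ring.
rewrite -(bigA_distr_bigA (fun j (i : 'I_N) => expi ((m 0 j)%:~R / N%:R * i%:R))).
under eq_bigr do rewrite sum_expi //.
case: asboolP => [/(NLambdaP AP)[y]|mP].
  rewrite -scaler_nat scalemxAl scaler_nat => myP.
  have mE : m = y *+ N.
    apply/eqP; rewrite -subr_eq0; apply: contraNT detP => my0; apply/det0P.
    by exists (m - y *+ N) => //; rewrite mulmxBl myP subrr.
  under eq_bigr => j _.
    rewrite (_ : (N %| m 0%R j)%Z = true); first over.
    by rewrite mE mulmxnE -mulr_natr natz dvdz_mull.
  by rewrite prodr_const card_ord natrX.
have [j Nj] : exists j, ~~ (N %| m 0%R j)%Z.
  apply: contra_notP mP => /forallNP Nm; apply/(NLambdaP AP).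
  have {}Nm j : (N %| m 0%R j)%Z by apply/negPn/negP; exact: Nm.
  exists (\row_j (m 0%R j %/ N)%Z); rewrite -scaler_nat scalemxAl scaler_nat.
  by congr (_ *m _); apply/rowP => j; rewrite mulmxnE mxE -mulr_natr natz divzK.
by rewrite (bigD1 j) //= (negbTE Nj) mul0r.
Qed.

Lemma power_sum k :
  \sum_y (`|Dhat A c (torsion_pt y)| ^+ 2) ^+ k =
  (\sum_(f : {ffun 'I_k -> A * A} | `[< closes N f >])
    (\prod_(i < k) (c (val (f i).1) * c (val (f i).2)))%N%:R) *+ (N ^ n) :> R[i].
Proof.
have expand y : (`|Dhat A c (torsion_pt y)| ^+ 2) ^+ k =
    \sum_(f : {ffun 'I_k -> A * A})
      (\prod_(i < k) (c (val (f i).1) * c (val (f i).2)))%N%:R *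
      expi (inner (torsion_pt y) (\sum_(i < k) (val (f i).1 - val (f i).2))).
  rewrite sqr_normDhat -[k in LHS]card_ord -prodr_const bigA_distr_bigA /=.
  apply: eq_bigr => f _.
  by rewrite inner_suml expi_sum natr_prod -big_split.
under eq_bigr do rewrite expand.
rewrite exchange_big -sumrMnl [RHS]big_mkcond; apply: eq_bigr => f _.
rewrite -mulr_sumr sum_torsion_expi; last first.
  apply: (big_ind Lambda) => [||i _]; [exact: (Lambda0 AP)|exact: (LambdaD AP)|].
  by apply: Lambda_sub; exact: valP.
by rewrite /closes; case: ifP => _; rewrite ?mulr0 // mulr_natr.
Qed.

Definition eigen (y : {ffun 'I_n -> 'I_N}) : R :=
  complex.Re (`|Dhat A c (torsion_pt y)| ^+ 2).

Lemma eigenE y : (eigen y)%:C = `|Dhat A c (torsion_pt y)| ^+ 2.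
Proof. by rewrite RRe_real // ger0_real // exprn_ge0. Qed.

Lemma multE r : mult A c N r = #|[pred y | eigen y == r]|.
Proof.
pose coset y := translate dual (torsion_pt y).
have coset_inj : injective coset.
  by move=> y y' /(translate_eq _ _ dual0 dualB)/torsion_pt_inj.
have N0 : N%:R != 0 :> R by rewrite pnatr_eq0 -lt0n.
pose s := [seq coset y | y <- enum [pred y | eigen y == r]].
rewrite /mult (_ : [set C | _] = [set` [fset C in s]%fset]).
  by rewrite set_fsetK card_fseq undup_id ?size_map -?cardE // map_inj_uniq ?enum_uniq.
apply/seteqP; split=> C /=.
  move=> [[_ [t dt <-] <-] Cr]; have [y dy] := torsion_ptP dt.
  have CE : translate dual (N%:R^-1 *: t) = coset y.
    exact/(translate_eq _ _ dual0 dualB).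
  rewrite CE !inE map_f // mem_enum inE -(inj_eq (@complexI R)) eigenE.
  by apply/eqP/Cr; rewrite CE; exists 0; [exact: dual0|rewrite addr0].
rewrite !inE => /mapP[y]; rewrite mem_enum inE => /eqP yr ->; split.
  exists (torsion_pt y) => //; exists (N%:R *: torsion_pt y).
    exact: torsion_pt_dual.
  by rewrite scalerA mulVf // scale1r.
by move=> _ [s' ds <-]; rewrite sqr_normDhat_periodic // -eigenE yr.
Qed.

Lemma BpolyE : Bpoly R A c N = \prod_y ('X - (eigen y)%:P).
Proof.
rewrite /Bpoly (fsbigTE [fset eigen y | y in {ffun 'I_n -> 'I_N}]%fset) => [|r rF].
  under eq_bigr do rewrite multE -prodr_const big_mkcond.
  rewrite exchange_big; apply: eq_bigr => y _ /=.
  rewrite (bigD1_seq (eigen y)) ?fset_uniq ?in_imfset //=.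
  rewrite inE eqxx [X in _ * X]big1 ?mulr1 // => r /negPf ry.
  by rewrite inE eq_sym ry.
rewrite multE eq_card0 // => y; rewrite !inE; apply/negP => /eqP yr.
by rewrite -yr in_imfset in rF.
Qed.

Lemma norm_expi (x : R) : `|expi x| = 1.
Proof.
apply/eqP; rewrite -sqrp_eq1 // sqr_normc.
by rewrite -expiN -expiD subrr expi0.
Qed.

Lemma eigen_le y : (eigen y)%:C <= ((\sum_(a <- A) c a) ^ 2)%N%:R.
Proof.
rewrite eigenE natrX lerXn2r ?nnegrE // natr_sum.
rewrite (le_trans (ler_norm_sum _ _ _)) // ler_sum // => a _.
by rewrite normrM normr_nat -/(expi _) norm_expi mulr1.
Qed.

Lemma eigen_ge0 y : 0 <= (eigen y)%:C.
Proof. by rewrite eigenE exprn_ge0. Qed.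

End Spectrum.

Lemma cvg_finite_sum (K : numFieldType) (V : normedModType K) (I : finType)
    (f : I -> nat -> V) (l : I -> V) :
  (forall i, f i m @[m --> \oo] --> l i) ->
  \sum_i f i m @[m --> \oo] --> \sum_i l i.
Proof.
move=> fl; elim: (index_enum I) => [|i s IH].
  rewrite big_nil (_ : (fun m => _) = fun=> 0); first exact: cvg_cst.
  by apply/funext => m; rewrite big_nil.
rewrite big_cons (_ : (fun m => _) = fun m => f i m + \sum_(j <- s) f j m).
  exact: cvgD.
by apply/funext => m; rewrite big_cons.
Qed.

Theorem theorem1 (R : realType) (n : nat) (A : {fset 'rV[int]_n})
    (c : 'rV[int]_n -> nat)
    (c_gt0 : forall a, a \in A -> (0 < c a)%N)
    (rank_n : lattice_rank (diff_lattice A) n)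
    (A_Lambda : [set` A] `&` diff_lattice A = set0)
    (N : nat) (N_gt0 : (0 < N)%N)
    (z : R[i]) (z_large : ((\sum_(a <- A) c a) ^ 2)%N%:R < `|z|) :
  let S (m : nat) : R[i]^o :=
    \sum_(1 <= k < m)
      \sum_(g \in closed_paths A N k) (path_weight c g)%:R * (z ^- k / k%:R) in
  cvgn S /\
  (map_poly (real_complex R) (Bpoly R A c N)).[z] =
    z ^+ (N ^ n) * cexp (- limn S).
Proof.
move=> S.
have [P AP] := diff_lattice_basis A.
have detP := det_basis_neq0 AP rank_n.
pose rho := @eigen R n A c P N.
have z0 : z != 0 by rewrite -normr_gt0 (le_lt_trans _ z_large).
have w1 y : `|(rho y)%:C / z| < 1.
  rewrite normrM normfV ltr_pdivrMr ?normr_gt0 // mul1r.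
  by rewrite ger0_norm ?eigen_ge0 // (le_lt_trans (@eigen_le R n A c P N y)).
have /choice[L LP] : forall y, exists L : R[i],
    (\sum_(1 <= k < m) ((rho y)%:C / z) ^+ k / k%:R : R[i]^o) @[m --> \oo]
      --> (L : R[i]^o) /\ (1 - (rho y)%:C / z) * cexp L = 1.
  by move=> y; have [L ? ?] := cvg_log_series (w1 y); exists L.
have SE : S = fun m => \sum_y \sum_(1 <= k < m) ((rho y)%:C / z) ^+ k / k%:R.
  apply/funext => m; rewrite /S [RHS]exchange_big.
  apply: eq_big_nat => k /andP[k0 _].
  rewrite (sum_closed_paths c A_Lambda AP detP N_gt0 k0
    (fun w => w%:R * (z ^- k / k%:R))).
  rewrite -mulr_suml -mulrnAl -(power_sum R c AP detP N_gt0) mulr_suml.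
  by apply: eq_bigr => y _; rewrite -eigenE expr_div_n mulrA.
have Slim : S m @[m --> \oo] --> (\sum_y L y : R[i]^o).
  by rewrite SE; apply: (@cvg_finite_sum _ R[i]^o) => y; have [] := LP y.
split; first by apply/cvg_ex; exists (\sum_y L y).
rewrite (cvg_lim (@norm_hausdorff _ _) Slim) (BpolyE R c AP detP N_gt0).
rewrite -sumrN cexp_sum rmorph_prod horner_prod.
rewrite (_ : (N ^ n)%N = #|{ffun 'I_n -> 'I_N}|); last by rewrite card_ffun !card_ord.
rewrite -prodr_const -big_split /=; apply: eq_bigr => y _.
rewrite rmorphB /= map_polyX map_polyC hornerXsubC.
have [_ Ly] := LP y.
have -> : cexp (- L y) = 1 - (rho y)%:C / z.
  by rewrite -[LHS]mul1r -{1}Ly -mulrA -cexpD subrr cexp0 mulr1.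
by rewrite mulrBr mulr1 mulrCA mulfV // mulr1.
Qed.
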